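(* Let $f:\mathbb{R}^n\to\mathbb{R}$ be a convex function satisfying $f(y)-f(x)-\langle f'(x),y-x\rangle\ge\frac\mu2\|y-x\|^2$ for all $x,y\in\mathbb{R}^n$, for some $\mu>0$, as well as the smoothness condition given in the context with constants $M>0$ and $\rho\in[0,1]$, and let $f^*=\min_{x\in\mathbb{R}^n}f(x)$. Suppose that $\{\alpha_k\}_{k\ge1}$ in procedure $\tilde{\mathcal{G}}_{FAPL}$ are chosen such that the stepsize condition (given in the context) holds with some constant $c>0$. Then the total number of iterations performed by the modified FAPL method for computing an $\epsilon$-solution of $\min_{x\in\mathbb{R}^n}f(x)$ is bounded by $$\widetilde{S}\left(\sqrt{\frac{2cM}{\theta\beta\mu}}+1\right)\quad\text{and}\quad\widetilde{S}+\frac{1}{1-q^{\frac{1-\rho}{1+3\rho}}}\left(\frac{4^{1+\rho}cM}{\theta\beta(1+\rho)\mu^{\frac{1+\rho}{2}}\epsilon^{\frac{1-\rho}{2}}}\right)^{\frac{2}{1+3\rho}},$$ respectively, for smooth strongly convex functions (i.e., $\rho=1$) and nonsmooth or weakly smooth strongly convex functions (i.e., $\rho\in[0,1)$), where $q:=\max\{\beta,1-(1-\theta)\beta\}$, $\mathrm{lb}_1$ and $\mathrm{ub}_1$ are the given initial lower bound and upper bound on $f^*$, and $$\widetilde{S}:=\left\lceil\log_{\frac1q}\left(\frac{\mathrm{ub}_1-\mathrm{lb}_1}{\epsilon}\right)\right\rceil.$$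
   Context: $\|\cdot\|$ is the Euclidean norm, $f'(x)\in\partial f(x)$ is a subgradient, $B(z,r)=\{x\in\mathbb{R}^n:\|x-z\|\le r\}$, $h(z,x):=f(z)+\langle f'(z),x-z\rangle$. An $\epsilon$-solution is a point $\hat x$ with $f(\hat{x})-f^*\le\epsilon$. Smoothness condition: for a given initial point $\overline{x}$, with $D^*$ the distance from $\overline{x}$ to the set of minimizers of $f$, for all closed sets $\Omega\subseteq B(\overline{x},4D^* )$ there exist $M(\Omega)>0$ and $\rho(\Omega)\in[0,1]$ such that $f(y)-f(x)-\langle f'(x),y-x\rangle\le\frac{M(\Omega)}{1+\rho(\Omega)}\|y-x\|^{1+\rho(\Omega)}$ for all $x,y\in\Omega$; $M$ and $\rho$ denote the constants in this condition. Stepsize condition with constant $c>0$: $\alpha_1=1$, $0<\alpha_k\le1$, and $\gamma_k\|\tau_k(\rho)\|_{\frac{2}{1-\rho}}\le ck^{-\frac{1+3\rho}{2}}$ for all $k\ge1$, where $\|\cdot\|_p$ is the $l_p$ norm ($p=\infty$ if $\rho=1$), $\gamma_1=1$, $\gamma_k=\gamma_{k-1}(1-\alpha_k)$ for $k\ge2$, and $\tau_k(\rho)=\left\{\frac{\alpha_1^{1+\rho}}{\gamma_1},\ldots,\frac{\alpha_k^{1+\rho}}{\gamma_k}\right\}$. Procedure $(x^+,\mathrm{lb}^+)=\tilde{\mathcal{G}}_{FAPL}(\hat{x},\mathrm{lb},r,\beta,\theta)$: Step 0. Set $k=1$, $\overline{f}_0=f(\hat{x})$, $l=\beta\,\mathrm{lb}+(1-\beta)\overline{f}_0$,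 $Q_0=\mathbb{R}^n$, $x_0^u=\hat{x}$. Let $x_0\in B(\hat{x},r)$ be given arbitrarily. Step 1. Set $x_k^l=(1-\alpha_k)x_{k-1}^u+\alpha_kx_{k-1}$ and $\underline{Q}_k=\{x\in Q_{k-1}:h(x_k^l,x)\le l\}$. Step 2. Set $x_k=\mathrm{argmin}_{x\in\underline{Q}_k}\frac12\|x-\hat{x}\|^2$. If $\underline{Q}_k=\emptyset$ or $\|x_k-\hat{x}\|>r$, terminate with $x^+=x_{k-1}^u$, $\mathrm{lb}^+=l$. Step 3. Set $\tilde{x}_k^u=(1-\alpha_k)x_{k-1}^u+\alpha_kx_k$; $x_k^u=\tilde{x}_k^u$ if $f(\tilde{x}_k^u)<\overline{f}_{k-1}$ and $x_k^u=x_{k-1}^u$ otherwise; $\overline{f}_k=f(x_k^u)$. If $\overline{f}_k\le l+\theta(\overline{f}_0-l)$, terminate with $x^+=x_k^u$, $\mathrm{lb}^+=\mathrm{lb}$. Step 4. Choose any polyhedral set $Q_k$ with $\underline{Q}_k\subseteq Q_k\subseteq\{x\in\mathbb{R}^n:\langle x_k-\hat{x},x-x_k\rangle\ge0\}$; set $k=k+1$ and go to Step 1. Modified FAPL method. Choose an initial lower bound $\mathrm{lb}_1\le f^*$, initial point $p_0\in\mathbb{R}^n$, initial upper bound $\mathrm{ub}_1=f(p_0)$, tolerance $\epsilon>0$ and parameters $\beta,\theta\in(0,1)$. Set $\hat{x}_1=p_0$, $s=1$. While $\mathrm{ub}_s-\mathrm{lb}_s>\epsilon$: set $(\hat{x}_{s+1},\mathrm{lb}_{s+1})=\tilde{\mathcal{G}}_{FAPL}\left(\hat{x}_s,\mathrm{lb}_s,\sqrt{2(f(\hat{x}_s)-\mathrm{lb}_s)/\mu},\beta,\theta\right)$,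 $\mathrm{ub}_{s+1}=f(\hat{x}_{s+1})$, $s\leftarrow s+1$. When $\mathrm{ub}_s-\mathrm{lb}_s\le\epsilon$, terminate and output $\hat{x}_s$. Iterations of the method are the iterations of procedure $\tilde{\mathcal{G}}_{FAPL}$.
   Formalization: M and ρ are taken as the constants of a closed Ω⊆B(x̄,4D* ) assumed to contain all search points x_k^l and x̃_k^u of the run (the bound fails if they leave Ω), and S̃ is replaced by max(0,S̃), since the ceiling can be negative when no iteration occurs. *)

(* Defs.v *)
(* MathComp-Analysis, over an arbitrary real field [R : realType]. *)
From HB Require Import structures.
From mathcomp Require Import all_boot all_order all_algebra.
From mathcomp Require Import all_classical all_reals all_analysis.
Set Implicit Arguments.
Unset Strict Implicit.
Unset Printing Implicit Defensive.
Import Order.TTheory GRing.Theory Num.Theory.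
Import numFieldNormedType.Exports.

Local Open Scope classical_set_scope.
Local Open Scope ring_scope.

Section Euclidean.
Context {R : realType} {n : nat}.
Implicit Types (x y z : 'rV[R]_n) (Q Omega : set 'rV[R]_n).

Definition dot x y : R := \sum_(i < n) x 0 i * y 0 i.

(* The library norm on ['rV[R]_n] is the sup norm. *)
Definition enorm x : R := Num.sqrt (dot x x).

Definition eball z (r : R) : set 'rV[R]_n := [set x | enorm (x - z) <= r].

Definition polyhedral Q : Prop :=
  exists (m : nat) (A : 'M[R]_(m, n)) (b : 'I_m -> R),
    Q = [set x | forall i, dot (row i A) x <= b i].

End Euclidean.

Section FunctionClasses.
Context {R : realType} {n : nat}.
Implicit Types (f : 'rV[R]_n -> R).
Implicit Types (x y z xbar : 'rV[R]_n) (Omega : set 'rV[R]_n).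

Definition convex_fun f : Prop := convex_function (E := 'rV[R]_n) [set: _] f.

Definition subgradient_selection f (f' : 'rV[R]_n -> 'rV[R]_n) : Prop :=
  forall x y, f x + dot (f' x) (y - x) <= f y.

(* h(z, x) *)
Definition linearization f (f' : 'rV[R]_n -> 'rV[R]_n) z x : R :=
  f z + dot (f' z) (x - z).

Definition strongly_convex f (f' : 'rV[R]_n -> 'rV[R]_n) (mu : R) : Prop :=
  forall x y, mu / 2 * enorm (y - x) ^+ 2 <= f y - f x - dot (f' x) (y - x).

Definition minimizers f : set 'rV[R]_n := [set z | forall x, f z <= f x].

Definition is_min_value f (fstar : R) : Prop :=
  exists2 z, minimizers f z & f z = fstar.

(* D^* *)
Definition dist_to_minimizers f xbar : R :=
  inf [set enorm (xbar - z) | z in minimizers f].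

Definition eps_solution f (fstar eps : R) x : Prop := f x - fstar <= eps.

Definition smooth_on f (f' : 'rV[R]_n -> 'rV[R]_n) Omega (M rho : R) : Prop :=
  forall x y, Omega x -> Omega y ->
    f y - f x - dot (f' x) (y - x)
      <= M / (1 + rho) * enorm (y - x) `^ (1 + rho).

(* The constants M(Omega) and rho(Omega) are given as functions of Omega. *)
Definition smoothness_condition f (f' : 'rV[R]_n -> 'rV[R]_n) xbar
    (M rho : set 'rV[R]_n -> R) : Prop :=
  forall Omega, closed Omega ->
    Omega `<=` eball xbar (4 * dist_to_minimizers f xbar) ->
    [/\ 0 < M Omega, 0 <= rho Omega <= 1
      & smooth_on f f' Omega (M Omega) (rho Omega)].

End FunctionClasses.

Section Stepsizes.
Context {R : realType}.
Implicit Types (alpha : nat -> R) (rho c : R) (k : nat).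

(* Steps are numbered from 1; the value at 0 is never used. *)
Fixpoint gamma_ alpha k : R :=
  match k with
  | 0 | 1 => 1
  | k'.+1 => gamma_ alpha k' * (1 - alpha k)
  end.

Definition tau_ alpha rho k : 'I_k -> R :=
  fun i => alpha i.+1 `^ (1 + rho) / gamma_ alpha i.+1.

Definition lp_norm (p : \bar R) k (v : 'I_k -> R) : R :=
  match p with
  | p%:E => (\sum_(i < k) `|v i| `^ p) `^ p^-1
  | +oo%E => \big[Num.max/0]_(i < k) `|v i|
  | -oo%E => 0
  end.

(* 2 / (1 - rho), read as +oo when rho = 1 *)
Definition tau_exponent rho : \bar R :=
  if rho == 1 then +oo%E else (2 / (1 - rho))%:E.

(* [gamma_ alpha k != 0] says that tau_k is well defined: since division by 0
   is total here, alpha_k = 1 with k >= 2 would otherwise be admissible. *)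
Definition stepsize_condition alpha rho c : Prop :=
  alpha 1%N = 1 /\
  forall k, (1 <= k)%N ->
    [/\ 0 < alpha k <= 1, gamma_ alpha k != 0
      & gamma_ alpha k * lp_norm (tau_exponent rho) (@tau_ alpha rho k)
          <= c * k%:R `^ (- ((1 + 3 * rho) / 2))].

End Stepsizes.

(* The state between two consecutive iterations of the gap reduction procedure:
   the number k of completed iterations, x_k, x_k^u and Q_k. *)
Record gap_state (R : realType) (n : nat) := GapState {
  st_k : nat;
  st_x : 'rV[R]_n;
  st_xu : 'rV[R]_n;
  st_Q : set 'rV[R]_n
}.

Variant gap_outcome (R : realType) (n : nat) :=
| Continue of gap_state R n
| Return of 'rV[R]_n & R. (* x^+ and lb^+ *)

Section GapReduction.
Context {R : realType} {n : nat}.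
Variables (f : 'rV[R]_n -> R) (f' : 'rV[R]_n -> 'rV[R]_n).
Variables (alpha : nat -> R) (beta theta : R).
Variables (xhat : 'rV[R]_n) (lb r : R).
Implicit Types (x : 'rV[R]_n) (Q : set 'rV[R]_n) (st : gap_state R n).

Definition gap_init (x0 : 'rV[R]_n) : gap_state R n :=
  GapState 0%N x0 xhat [set: _].

Definition level : R := beta * lb + (1 - beta) * f xhat.

(* In the next four definitions [st] is the state after k - 1 iterations. *)

(* x_k^l *)
Definition lower_pt st : 'rV[R]_n :=
  let a := alpha (st_k st).+1 in (1 - a) *: st_xu st + a *: st_x st.

(* \underline{Q}_k *)
Definition lower_set st : set 'rV[R]_n :=
  [set x | st_Q st x /\ linearization f f' (lower_pt st) x <= level].

(* \tilde x_k^u, where x is x_k *)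
Definition trial_pt st x : 'rV[R]_n :=
  let a := alpha (st_k st).+1 in (1 - a) *: st_xu st + a *: x.

(* x_k^u *)
Definition upper_pt st x : 'rV[R]_n :=
  if f (trial_pt st x) < f (st_xu st) then trial_pt st x else st_xu st.

Definition is_prox Q x : Prop :=
  Q x /\ forall y, Q y ->
    2^-1 * enorm (x - xhat) ^+ 2 <= 2^-1 * enorm (y - xhat) ^+ 2.

(* [gap_iter st pts out]: one iteration from [st] may produce [out]; [pts] lists
   the search points x_k^l and (unless the iteration ends in Step 2)
   \tilde x_k^u at which f or f' is evaluated. *)
Inductive gap_iter st : seq 'rV[R]_n -> gap_outcome R n -> Prop :=
| GapEmpty :
    lower_set st = set0 ->
    gap_iter st [:: lower_pt st] (Return (st_xu st) level)
| GapFar x :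
    is_prox (lower_set st) x ->
    r < enorm (x - xhat) ->
    gap_iter st [:: lower_pt st] (Return (st_xu st) level)
| GapUpper x :
    is_prox (lower_set st) x ->
    enorm (x - xhat) <= r ->
    f (upper_pt st x) <= level + theta * (f xhat - level) ->
    gap_iter st [:: lower_pt st; trial_pt st x] (Return (upper_pt st x) lb)
| GapContinue x Q :
    is_prox (lower_set st) x ->
    enorm (x - xhat) <= r ->
    level + theta * (f xhat - level) < f (upper_pt st x) ->
    polyhedral Q ->
    lower_set st `<=` Q ->
    Q `<=` [set y | 0 <= dot (x - xhat) (y - x)] ->
    gap_iter st [:: lower_pt st; trial_pt st x]
      (Continue (GapState (st_k st).+1 x (upper_pt st x) Q)).

End GapReduction.

(* Either the method is at the test of the while loop with current
   (xhat_s, lb_s), or it is inside the call of the procedure on that pair. *)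
Variant fapl_config (R : realType) (n : nat) :=
| AtTest of 'rV[R]_n & R
| InCall of 'rV[R]_n & R & gap_state R n.

Section ModifiedFAPL.
Context {R : realType} {n : nat}.
Variables (f : 'rV[R]_n -> R) (f' : 'rV[R]_n -> 'rV[R]_n).
Variables (alpha : nat -> R) (beta theta mu eps : R).
Variables (p0 : 'rV[R]_n) (lb1 : R).

Definition call_radius (xhat : 'rV[R]_n) (lb : R) : R :=
  Num.sqrt (2 * (f xhat - lb) / mu).

(* [fapl_step cfg N pts cfg']: a transition consisting of [N] (0 or 1)
   iterations, with search points [pts]. *)
Inductive fapl_step :
  fapl_config R n -> nat -> seq 'rV[R]_n -> fapl_config R n -> Prop :=
| StepCall xhat lb x0 :
    eps < f xhat - lb ->
    eball xhat (call_radius xhat lb) x0 ->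
    fapl_step (AtTest xhat lb) 0%N [::] (InCall xhat lb (gap_init xhat x0))
| StepContinue xhat lb st pts st' :
    gap_iter f f' alpha beta theta xhat lb (call_radius xhat lb) st pts
      (Continue st') ->
    fapl_step (InCall xhat lb st) 1%N pts (InCall xhat lb st')
| StepReturn xhat lb st pts xhat' lb' :
    gap_iter f f' alpha beta theta xhat lb (call_radius xhat lb) st pts
      (Return xhat' lb') ->
    fapl_step (InCall xhat lb st) 1%N pts (AtTest xhat' lb').

(* [fapl_run cfg N pts]: some (possibly unfinished) execution leads to [cfg]
   after [N] iterations in total, with search points [pts]. *)
Inductive fapl_run : fapl_config R n -> nat -> seq 'rV[R]_n -> Prop :=
| RunStart : fapl_run (AtTest p0 lb1) 0%N [::]
| RunStep cfg N pts N' pts' cfg' :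
    fapl_run cfg N pts ->
    fapl_step cfg N' pts' cfg' ->
    fapl_run cfg' (N + N')%N (pts ++ pts').

End ModifiedFAPL.

Section Bounds.
Context {R : realType}.
Implicit Types (beta theta eps c M mu rho : R).

Definition contraction beta theta : R := Num.max beta (1 - (1 - theta) * beta).

Definition log_base (b x : R) : R := ln x / ln b.

(* Truncated at 0: the ceiling is negative when gap is much smaller than eps,
   in which case no iteration is performed. It is nonnegative whenever
   gap > eps. *)
Definition call_bound beta theta eps (gap : R) : int :=
  Num.max 0 (Num.ceil (log_base (1 / contraction beta theta) (gap / eps))).

Definition smooth_bound beta theta mu c M (S : int) : R :=
  S%:~R * (Num.sqrt (2 * c * M / (theta * beta * mu)) + 1).

Definition weakly_smooth_bound beta theta mu eps c M rho (S : int) : R :=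
  S%:~R
  + 1 / (1 - contraction beta theta `^ ((1 - rho) / (1 + 3 * rho)))
    * ((4 `^ (1 + rho) * c * M)
       / (theta * beta * (1 + rho) * mu `^ ((1 + rho) / 2)
          * eps `^ ((1 - rho) / 2))) `^ (2 / (1 + 3 * rho)).

End Bounds.

(* Main.v *)
Require Import Defs.
From HB Require Import structures.
From mathcomp Require Import all_boot all_order all_algebra.
From mathcomp Require Import all_classical all_reals all_analysis.
From mathcomp Require Import ring lra.
Set Implicit Arguments.
Unset Strict Implicit.
Unset Printing Implicit Defensive.
Import Order.TTheory GRing.Theory Num.Theory.
Import numFieldNormedType.Exports.

Local Open Scope classical_set_scope.
Local Open Scope ring_scope.

(** The work of the method splits into the length of one call of the gap
reduction procedure and the number of calls.

Number of calls. A call started with gap [D = f xhat - lb] returns a gap at most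
[q D].  If it stops at its upper test, that test says so.  If it stops because
[lower_set] is empty or too far away, the level [l] is a valid lower bound: were
the minimum value at most [l], every cut and every [Q_k] would retain the
minimizer [z], which strong convexity puts within the radius [sqrt (2 D / mu)]
of [xhat], and the call could not have stopped there ([return_sound]).  Since
calls are only made while the gap exceeds [eps], there are at most [S] of them
([call_bound_gt]).

Length of a call. Convexity and smoothness at the search points give a recursion
for [(f x_k^u - l) / gamma_k]; summing it bounds this quantity by
[M / (1 + rho)] times the sum of [tau_i d_i^(1 + rho)], where
[d_i = |x_i - x_(i-1)|].  Hoelder's inequality separates the norm of [tau_k],
controlled by the stepsize condition, from the sum of the [d_i^2], which
telescopes because [x_i] lies in the half-space cut out by the projection
[x_(i-1)].  The first displacement does not telescope: [x_0] is an arbitrary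
point of the ball, and [d_1] may be as large as [2 r].  It may nevertheless be
replaced by [min d_1 r] ([first_upper_estimate]): a displacement longer than [r]
between two points where both strong convexity and smoothness hold forces
[mu / 2 * r^2 <= M / (1 + rho) * r^(1 + rho)], and the left-hand side is the
initial gap [D], an upper bound of [f x_1^u - l].  Hence the sum of squares is at
most [2 r^2], which is what the constant [2 c M] of the smooth case requires.
As long as the call has not stopped, [f x_k^u - l > theta beta D], so a call
started with gap [D] has at most [A D^(-e)] iterations besides the one that ends
it, with [e = (1 - rho) / (1 + 3 rho)] ([call_length_le]).

Total. The gaps of successive calls shrink by the factor [q] and all exceed
[eps]; read backwards from the last one they grow at least geometrically, so the
bounds [A D^(-e)] are dominated by [A eps^(-e)] times the partial sums of
[sum_j q^(e j)].  For [rho = 1] every term is 1 and the partial sum is the number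
of calls; for [rho < 1] the series converges to [1 / (1 - q^e)].

Progress holds because [lower_set] is always a polyhedron: it is empty or has a
nearest point to [xhat], and then the half-space of that projection is an
admissible choice of [Q_k]. *)

(** * Euclidean geometry and projections *)

Lemma continuous_sum {R : realType} {T : topologicalType} {n : nat}
    (F : 'I_n -> T -> R) :
  (forall i, continuous (F i)) -> continuous (fun x => \sum_(i < n) F i x).
Proof.
move=> Fc x; apply: cvg_big => [|i _]; last exact: Fc.
exact: (@add_continuous R).
Qed.

Section EuclideanFacts.
Context {R : realType} {n : nat}.
Implicit Types (u v w x y z : 'rV[R]_n) (a t : R) (Q : set 'rV[R]_n).

Lemma dotC u v : dot u v = dot v u.
Proof. by apply: eq_bigr => i _; rewrite mulrC. Qed.

Lemma dotDr u v w : dot u (v + w) = dot u v + dot u w.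
Proof. by rewrite -big_split; apply: eq_bigr => i _; rewrite mxE mulrDr. Qed.

Lemma dotZr a u v : dot u (a *: v) = a * dot u v.
Proof. by rewrite mulr_sumr; apply: eq_bigr => i _; rewrite mxE mulrCA. Qed.

Lemma dotDl u v w : dot (u + v) w = dot u w + dot v w.
Proof. by rewrite !(dotC _ w) dotDr. Qed.

Lemma dotZl a u v : dot (a *: u) v = a * dot u v.
Proof. by rewrite !(dotC _ v) dotZr. Qed.

Lemma dotNr u v : dot u (- v) = - dot u v.
Proof. by rewrite -scaleN1r dotZr mulN1r. Qed.

Lemma dotBr u v w : dot u (v - w) = dot u v - dot u w.
Proof. by rewrite dotDr dotNr. Qed.

Lemma dot_ge0 u : 0 <= dot u u.
Proof. by apply: sumr_ge0 => i _; rewrite -expr2 sqr_ge0. Qed.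

Lemma enorm_ge0 u : 0 <= enorm u.
Proof. exact: sqrtr_ge0. Qed.

Lemma sqr_enorm u : enorm u ^+ 2 = dot u u.
Proof. by rewrite sqr_sqrtr ?dot_ge0. Qed.

Lemma enormZ a u : 0 <= a -> enorm (a *: u) = a * enorm u.
Proof.
move=> a0; rewrite /enorm dotZl dotZr mulrA -expr2 sqrtrM ?sqr_ge0//.
by rewrite sqrtr_sqr ger0_norm.
Qed.

Lemma enorm0 : enorm (0 : 'rV[R]_n) = 0.
Proof. by rewrite -(scale0r 0) enormZ// mul0r. Qed.

Lemma enormN u : enorm (- u) = enorm u.
Proof. by rewrite /enorm dotNr dotC dotNr opprK. Qed.

Lemma sqr_enormD u v :
  enorm (u + v) ^+ 2 = enorm u ^+ 2 + 2 * dot u v + enorm v ^+ 2.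
Proof. by rewrite !sqr_enorm dotDl !dotDr (dotC v u); ring. Qed.

Lemma ler_coord_enorm u i : `|u ord0 i| <= enorm u.
Proof.
rewrite -sqrtr_sqr /enorm ler_sqrt ?dot_ge0// /dot (bigD1 i)//= -expr2.
by rewrite lerDl sumr_ge0// => j _; rewrite -expr2 sqr_ge0.
Qed.

Lemma continuous_dotr u : continuous (dot u).
Proof.
apply: continuous_sum => i x.
by apply: continuousM; [exact: cst_continuous | exact: coord_continuous].
Qed.

Lemma continuous_sqr_enorm x :
  continuous (fun y => enorm (y - x) ^+ 2 : R).
Proof.
rewrite (_ : (fun y => _) = (fun y => dot (y - x) (y - x))); last first.
  by apply/funext => y; rewrite sqr_enorm.
apply: continuous_sum => i y.
have h : {for y, continuous (fun z : 'rV[R]_n => (z - x) 0 i)}.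
  rewrite (_ : (fun z => _) = (fun z : 'rV[R]_n => z 0 i - x 0 i)).
    by apply: continuousB; [exact: coord_continuous | exact: cst_continuous].
  by apply/funext => z; rewrite !mxE.
exact: continuousM.
Qed.

Definition convex_set Q := forall x y t, Q x -> Q y -> 0 <= t <= 1 ->
  Q ((1 - t) *: x + t *: y).

Lemma polyhedral_closed Q : polyhedral Q -> closed Q.
Proof.
move=> [m [A [b ->]]].
rewrite (_ : mkset _ =
  \bigcap_(i in [set: 'I_m]) (dot (row i A) @^-1` [set y | y <= b i])).
  apply: closed_bigI => i _; apply: preimage_closed; last exact: closed_le.
  by move=> x _; exact: continuous_dotr.
by apply/seteqP; split=> [x Hx i _|x Hx i]; exact: Hx.
Qed.

Lemma halfspace_convex u a : convex_set [set y | dot u y <= a].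
Proof.
move=> x y t /= Hx Hy /andP[t0 t1]; rewrite dotDr !dotZr.
have := ler_wpM2l t0 Hy; have := ler_wpM2l (_ : 0 <= 1 - t) Hx.
by rewrite subr_ge0 => /(_ t1); lra.
Qed.

Lemma polyhedral_convex Q : polyhedral Q -> convex_set Q.
Proof.
move=> [m [A [b ->]]] x y t /= Hx Hy t01 i.
exact: (halfspace_convex (Hx i) (Hy i) t01).
Qed.

Lemma polyhedral_setT : polyhedral ([set: 'rV[R]_n]).
Proof.
exists 0%N, 0, (fun=> 0); apply/seteqP; split=> // x _ /= i.
by have := ltn_ord i.
Qed.

Lemma polyhedral_halfspace u a : polyhedral [set y | a <= dot u y].
Proof.
have rowE i : row i (- u) = - u by apply/rowP => j; rewrite !mxE (ord1 i).
exists 1%N, (- u), (fun=> - a); apply/seteqP; split=> x /= h.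
  by move=> i; rewrite rowE dotC dotNr dotC lerN2.
by have := h ord0; rewrite rowE dotC dotNr dotC lerN2.
Qed.

(** First-order argument: an affine function of [t] that is nonnegative for small
[t > 0] is nonnegative at [0]. *)
Lemma ge0_of_small_slope (a b : R) :
  (forall t, 0 < t <= 1 -> 0 <= a + t * b) -> 0 <= a.
Proof.
move=> H; rewrite leNgt; apply/negP => a0.
have b0 : 0 <= `|b| by [].
have d0 : 0 < `|b| - a by lra.
(* At t = - a / (|b| - a) the term t |b| stays below - a. *)
have t01 : 0 < - a / (`|b| - a) <= 1.
  by rewrite divr_gt0 ?oppr_gt0// ler_pdivrMr//; lra.
have := H _ t01; apply/negP; rewrite -ltNge.
apply: (@le_lt_trans _ _ (a + - a / (`|b| - a) * `|b|)).
  by rewrite lerD2l ler_wpM2l ?ler_norm//; case/andP: t01 => /ltW.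
rewrite -ltrBrDl add0r mulrAC ltr_pdivrMr// ltr_pM2l; lra.
Qed.

End EuclideanFacts.

Section Projection.
Context {R : realType} {n : nat}.
Variable xhat : 'rV[R]_n.
Implicit Types (Q : set 'rV[R]_n) (x y : 'rV[R]_n).

Lemma is_prox_enorm_le Q x y : is_prox xhat Q x -> Q y ->
  enorm (x - xhat) <= enorm (y - xhat).
Proof.
move=> [_ H] /H; rewrite ler_pM2l ?invr_gt0// ler_sqr// nnegrE;
  exact: enorm_ge0.
Qed.

(** Only the part of [Q] inside a Euclidean ball matters; it is compact because
the sup norm, which gives the topology, is dominated by the Euclidean one. *)
Lemma prox_exists Q : closed Q -> Q !=set0 -> exists x, is_prox xhat Q x.
Proof.
move=> Qcl [q Qq].
pose g x : R := enorm (x - xhat) ^+ 2.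
pose A := Q `&` [set x | g x <= g q].
have Acl : closed A.
  apply: closedI => //.
  apply: (@preimage_closed _ _ g [set y | y <= g q]); last exact: closed_le.
  by move=> x _; exact: continuous_sqr_enorm.
have Abd : bounded_set A.
  exists (enorm (q - xhat) + `|xhat|); split; first exact: num_real.
  move=> M HM x [_ /= gx].
  have {gx} xq : enorm (x - xhat) <= enorm (q - xhat).
    by rewrite -ler_sqr ?nnegrE ?enorm_ge0.
  apply: (le_trans _ (ltW HM)); rewrite -{1}(subrK xhat x).
  apply: (le_trans (ler_normD _ _)); rewrite lerD2r.
  apply: (le_trans _ xq).
  rewrite [leLHS]/Num.norm /= mx_normrE; apply/bigmax_leP; split=> [|[i j] _ /=].
    exact: enorm_ge0.
  by rewrite ord1 ler_coord_enorm.
have A0 : A !=set0 by exists q; split => /=.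
have [c] := EVT_min_rV A0 (bounded_closed_compact Abd Acl)
  (continuous_subspaceT (@continuous_sqr_enorm _ _ xhat)).
rewrite inE => -[Qc cq] Hc; exists c; split=> // y Qy.
rewrite ler_pM2l ?invr_gt0//.
have [yq|qy] := leP (g y) (g q); first by apply: Hc; rewrite inE.
exact: (le_trans cq (ltW qy)).
Qed.

(** Moving from the nearest point towards [y] along the segment cannot decrease
the distance. *)
Lemma prox_variational Q x y : convex_set Q -> is_prox xhat Q x -> Q y ->
  0 <= dot (x - xhat) (y - x).
Proof.
move=> Qcv [Qx Hx] Qy.
suff: 0 <= 2 * dot (x - xhat) (y - x) by rewrite pmulr_rge0.
apply: (ge0_of_small_slope (b := enorm (y - x) ^+ 2)) => t /andP[t0 t1].
have t01 : 0 <= t <= 1 by rewrite ltW.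
have := Hx _ (Qcv _ _ _ Qx Qy t01).
rewrite ler_pM2l ?invr_gt0//.
have -> : (1 - t) *: x + t *: y - xhat = (x - xhat) + t *: (y - x).
  by apply/rowP => i; rewrite !mxE; ring.
rewrite (sqr_enormD (x - xhat)) dotZr (enormZ _ (ltW t0)) -addrA lerDl.
rewrite exprMn => h.
by rewrite -(pmulr_rge0 _ t0); apply: (le_trans h); lra.
Qed.

(** Obtuse angle at [x]: this is the inequality that makes the squared
displacements telescope. *)
Lemma enorm_step x y : 0 <= dot (x - xhat) (y - x) ->
  enorm (y - x) ^+ 2 <= enorm (y - xhat) ^+ 2 - enorm (x - xhat) ^+ 2.
Proof.
have -> : y - xhat = (x - xhat) + (y - x).
  by apply/rowP => i; rewrite !mxE; ring.
by move=> h; rewrite (sqr_enormD (x - xhat)); lra.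
Qed.

End Projection.

(** * Hoelder's inequality for the step weights *)

Section Stepsizes.
Context {R : realType}.
Implicit Types (alpha : nat -> R) (rho c : R) (k : nat).

Lemma gammaS alpha k : gamma_ alpha k.+2 = gamma_ alpha k.+1 * (1 - alpha k.+2).
Proof. by []. Qed.

Lemma lp_norm_ge0 (p : \bar R) k (v : 'I_k -> R) : 0 <= lp_norm p v.
Proof.
case: p => [p| |] //=; first exact: powR_ge0.
by elim/big_ind: _ => // x y x0 y0; rewrite le_max x0.
Qed.

(** Young's inequality applied termwise to the normalized families. *)
Lemma holder_sum k (a b : 'I_k -> R) (p q : R) :
  (forall i, 0 <= a i) -> (forall i, 0 <= b i) ->
  0 < p -> 0 < q -> p^-1 + q^-1 = 1 ->
  \sum_(i < k) a i * b i
    <= (\sum_(i < k) a i `^ p) `^ p^-1 * (\sum_(i < k) b i `^ q) `^ q^-1.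
Proof.
move=> a0 b0 p0 q0 pq.
have S0 (g : 'I_k -> R) s : 0 <= \sum_(i < k) g i `^ s.
  by apply: sumr_ge0 => i _; exact: powR_ge0.
have sum_eq0 (g : 'I_k -> R) s : 0 < s -> \sum_(i < k) g i `^ s = 0 ->
    forall i, g i = 0.
  move=> s0 /eqP; rewrite psumr_eq0 => [/allP h i|i _]; last exact: powR_ge0.
  by apply: (@powR_eq0_eq0 _ _ s); apply/eqP/h; rewrite mem_index_enum.
set A := \sum_(i < k) a i `^ p; set B := \sum_(i < k) b i `^ q.
have [A0|A0] := eqVneq A 0.
  rewrite big1 ?mulr_ge0 ?powR_ge0// => i _.
  by rewrite (sum_eq0 _ _ p0 A0) mul0r.
have [B0|B0] := eqVneq B 0.
  rewrite big1 ?mulr_ge0 ?powR_ge0// => i _.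
  by rewrite (sum_eq0 _ _ q0 B0) mulr0.
have {}A0 : 0 < A by rewrite lt_neqAle eq_sym A0 S0.
have {}B0 : 0 < B by rewrite lt_neqAle eq_sym B0 S0.
have An0 : 0 < A `^ p^-1 by exact: powR_gt0.
have Bn0 : 0 < B `^ q^-1 by exact: powR_gt0.
have AB0 := mulr_gt0 An0 Bn0.
rewrite -[leRHS]mul1r -ler_pdivrMr// mulr_suml -pq.
have normalized (g : 'I_k -> R) s (G : R) : (forall i, 0 <= g i) ->
    0 < s -> 0 < G -> G = \sum_(i < k) g i `^ s ->
    \sum_(i < k) (g i / G `^ s^-1) `^ s / s = s^-1.
  move=> g0 s0 G0 GE; rewrite -mulr_suml.
  rewrite -[RHS]mul1r; congr (_ * _).
  transitivity ((\sum_(i < k) g i `^ s) / G); last by rewrite -GE divff ?gt_eqF.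
  rewrite mulr_suml; apply: eq_bigr => i _.
  rewrite powRM ?invr_ge0 ?powR_ge0//; congr (_ * _).
  rewrite -[(G `^ _)^-1]powRN -powRrM mulNr mulVf ?gt_eqF//.
  by rewrite powRN powRr1 ?ltW.
rewrite -[X in _ <= X + _](normalized a p A)//.
rewrite -[X in _ <= _ + X](normalized b q B)//.
rewrite -big_split/=.
apply: ler_sum => i _; rewrite invfM mulrACA.
by apply: conjugate_powR => //; rewrite divr_ge0 ?powR_ge0.
Qed.

(** Hoelder with the conjugate exponents [2 / (1 - rho)] and [2 / (1 + rho)],
which degenerate to the pair [+oo], [1] when [rho = 1]. *)
Lemma holder_tau rho k (v d : 'I_k -> R) : 0 <= rho <= 1 ->
  (forall i, 0 <= d i) ->
  \sum_(i < k) `|v i| * d i `^ (1 + rho)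
    <= lp_norm (tau_exponent rho) v
       * (\sum_(i < k) d i ^+ 2) `^ ((1 + rho) / 2).
Proof.
move=> /andP[rho0 rho1] d0; rewrite /tau_exponent; case: eqVneq => [->|rhoN1] /=.
  have -> : (1 + 1) / 2 = 1 :> R by field.
  rewrite powRr1; last by apply: sumr_ge0 => i _; exact: sqr_ge0.
  rewrite mulr_sumr; apply: ler_sum => i _.
  rewrite (_ : 1 + 1 = 2%:R)// powR_mulrn// ler_wpM2r ?sqr_ge0//.
  exact: (le_bigmax_cond _ (fun j => `|v j|)).
have {rhoN1 rho1} rho1 : rho < 1 by rewrite lt_neqAle rhoN1.
have p0 : 0 < 2 / (1 - rho) by rewrite divr_gt0 ?subr_gt0.
have q0 : 0 < 2 / (1 + rho) by rewrite divr_gt0//; lra.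
have pq : (2 / (1 - rho))^-1 + (2 / (1 + rho))^-1 = 1.
  by rewrite !invf_div; field.
have := @holder_sum k (fun i => `|v i|) (fun i => d i `^ (1 + rho)) _ _
  (fun=> normr_ge0 _) (fun=> powR_ge0 _ _) p0 q0 pq.
rewrite (invf_div _ (1 + rho)) => /le_trans; apply.
rewrite le_eqVlt; apply/orP; left; apply/eqP; congr (_ * _ `^ _).
apply: eq_bigr => i _; rewrite -powRrM -powR_mulrn//; congr (_ `^ _).
by field; lra.
Qed.

End Stepsizes.

(** * Consequences of strong convexity *)

Section StrongConvexity.
Context {R : realType} {n : nat}.
Variables (f : 'rV[R]_n -> R) (f' : 'rV[R]_n -> 'rV[R]_n) (mu : R).
Hypothesis f_strong : strongly_convex f f' mu.

(** [f'] may select any subgradient, so [f' z] need not vanish at the minimizer.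
Strong convexity is used instead at a point [y] of the segment from [z] to [x],
which is then moved to [z]. *)
Lemma quadratic_growth z x : minimizers f z ->
  mu / 2 * enorm (x - z) ^+ 2 <= f x - f z.
Proof.
move=> fz; rewrite -subr_ge0.
apply: (ge0_of_small_slope (b := mu / 2 * enorm (x - z) ^+ 2)) => t /andP[t0 t1].
pose y := z + t *: (x - z).
have xy : x - y = (1 - t) *: (x - z) by apply/rowP => i; rewrite !mxE; ring.
have zy : z - y = - (t *: (x - z)) by apply/rowP => i; rewrite !mxE; ring.
have := f_strong y x; rewrite xy enormZ ?subr_ge0// dotZr exprMn => hx.
have := f_strong y z; rewrite zy enormN (enormZ _ (ltW t0)) dotNr dotZr exprMn.
move=> hz; have t1' : 0 <= 1 - t by rewrite subr_ge0.
have hy := fz y.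
move: (ler_wpM2l (ltW t0) hx) (ler_wpM2l t1' hz).
set d := enorm _ ^+ 2; set p := dot _ _ => {}hx {}hz.
by rewrite -(pmulr_rge0 _ t0); nra.
Qed.

(** For the distance [D] of [x] and [y] itself, the two sides bound the same
Bregman distance from below and from above.  Dividing by [D^(1 + rho)] leaves
the power [D^(1 - rho)] on the left only, so [D] can be decreased to [r]. *)
Lemma strong_smooth_compare (Om : set 'rV[R]_n) (M rho r : R) x y :
  smooth_on f f' Om M rho -> 0 <= M -> 0 <= rho <= 1 -> Om x -> Om y ->
  0 <= r <= enorm (y - x) ->
  mu / 2 * r ^+ 2 <= M / (1 + rho) * r `^ (1 + rho).
Proof.
move=> sm M0 /andP[rho0 rho1] Ox Oy /andP[r0 rD].
have [->|rN0] := eqVneq r 0.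
  by rewrite expr0n/= mulr0 mulr_ge0 ?powR_ge0// divr_ge0//; lra.
have {rN0} r0 : 0 < r by rewrite lt_neqAle eq_sym rN0.
set D := enorm (y - x) in rD.
have D0 : 0 < D by exact: lt_le_trans rD.
have sqrE s : 0 < s -> s ^+ 2 = s `^ (1 - rho) * s `^ (1 + rho).
  move=> s0; rewrite -powRD; last by rewrite (gt_eqF s0) implybT.
  by rewrite -powR_mulrn ?ltW//; congr (_ `^ _); ring.
have h : mu / 2 * D `^ (1 - rho) <= M / (1 + rho).
  rewrite -(ler_pM2r (powR_gt0 (1 + rho) D0)) -(mulrA (mu / 2)) -sqrE//.
  exact: le_trans (f_strong _ _) (sm _ _ Ox Oy).
rewrite sqrE// mulrA ler_wpM2r ?powR_ge0//.
have [mu0|mu0] := leP 0 mu; last first.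
  apply: (@le_trans _ _ 0); last by rewrite divr_ge0//; lra.
  by rewrite mulr_le0_ge0 ?powR_ge0//; lra.
apply: le_trans h; rewrite ler_wpM2l ?divr_ge0//.
by apply: ge0_ler_powR; rewrite ?nnegrE ?subr_ge0 ?(ltW r0) ?(ltW D0).
Qed.

End StrongConvexity.

(** * Soundness of the gap reduction procedure *)

Section GapReductionFacts.
Context {R : realType} {n : nat}.
Variables (f : 'rV[R]_n -> R) (f' : 'rV[R]_n -> 'rV[R]_n).
Variables (alpha : nat -> R) (beta theta : R).
Variables (xhat : 'rV[R]_n) (lb r : R).
Implicit Types (st : gap_state R n) (x z : 'rV[R]_n).
Local Notation lv := (level f beta xhat lb).
Local Notation iter := (gap_iter f f' alpha beta theta xhat lb r).
Hypothesis f'_sub : subgradient_selection f f'.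

Lemma upper_pt_le_trial st x :
  f (upper_pt f alpha st x) <= f (trial_pt alpha st x).
Proof. by rewrite /upper_pt; case: ltP. Qed.

Lemma upper_pt_le st x : f (upper_pt f alpha st x) <= f (st_xu st).
Proof. by rewrite /upper_pt; case: ltP => // /ltW. Qed.

Lemma lower_set_polyhedral st : polyhedral (st_Q st) ->
  polyhedral (lower_set f f' alpha beta xhat lb st).
Proof.
move=> [m [A [b QE]]].
pose z := lower_pt alpha st.
exists (m + 1)%N, (col_mx A (f' z)),
  (fun i : 'I_(m + 1) => match fintype.split i with
            | inl j => b j | inr _ => lv - f z + dot (f' z) z end).
have rowl j : row (lshift 1 j) (col_mx A (f' z)) = row j A.
  by apply/rowP => k; rewrite !mxE (unsplitK (inl j)).
have rowr j : row (rshift m j) (col_mx A (f' z)) = f' z.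
  by apply/rowP => k; rewrite !mxE (unsplitK (inr j)) ord1.
apply/seteqP; split=> x /=.
  move=> [] /[!QE] Qx; rewrite /linearization dotBr => hx i.
  case: (splitP i) => j ij.
    have -> : i = lshift 1 j by exact/val_inj.
    by rewrite rowl.
  have -> : i = rshift m j by exact/val_inj.
  by rewrite rowr -/z; rewrite -/z in hx; lra.
move=> hx; split.
  by rewrite QE => j; have := hx (lshift 1 j); rewrite rowl (unsplitK (inl j)).
have := hx (rshift m ord0); rewrite rowr (unsplitK (inr _)) /linearization dotBr.
by rewrite -/z; lra.
Qed.

(** [z] stands for a minimizer.  If the level is not below the minimum value, the
cuts retain [z]; this is what turns an empty or distant [lower_set] into a proof
that the level is a lower bound. *)
Record sound_state z st : Prop := SoundState {
  sound_polyhedral : polyhedral (st_Q st);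
  sound_cut : f z <= lv -> st_Q st z;
  sound_upper : f (st_xu st) <= f xhat }.

Lemma sound_init z x0 : sound_state z (gap_init xhat x0).
Proof. by split=> //=; exact: polyhedral_setT. Qed.

Lemma sound_lower_set z st : sound_state z st -> f z <= lv ->
  lower_set f f' alpha beta xhat lb st z.
Proof.
move=> snd zl; split; first exact: sound_cut snd zl.
exact: le_trans (f'_sub _ _) zl.
Qed.

Lemma sound_continue z st pts st' : sound_state z st ->
  iter st pts (Continue st') -> sound_state z st'.
Proof.
move=> snd it; inversion it as [| | |x Q px xr up polQ sub half]; subst.
split=> //= [zl|]; first exact/sub/sound_lower_set.
exact: le_trans (upper_pt_le _ _) (sound_upper snd).
Qed.

(** The half-space of the projection is polyhedral and contains [lower_set],
so there is always an admissible [Q_k]. *)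
Lemma iter_progress z st : sound_state z st -> exists pts out, iter st pts out.
Proof.
move=> snd.
have Lpol := lower_set_polyhedral (sound_polyhedral snd).
have [L0|/set0P LN0] := eqVneq (lower_set f f' alpha beta xhat lb st) set0.
  by do 2 eexists; exact: GapEmpty.
have [x px] := @prox_exists _ _ xhat _ (polyhedral_closed Lpol) LN0.
have [xr|rx] := leP (enorm (x - xhat)) r; last first.
  by do 2 eexists; exact: (GapFar theta px rx).
have [le|gt] := leP (f (upper_pt f alpha st x)) (lv + theta * (f xhat - lv)).
  by do 2 eexists; exact: (GapUpper px xr le).
exists [:: lower_pt alpha st; trial_pt alpha st x].
eexists; apply: (GapContinue px xr gt (polyhedral_halfspace (x - xhat)
  (dot (x - xhat) x))) => y /=.
  move=> Ly; rewrite -subr_ge0 -dotBr.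
  exact: prox_variational (polyhedral_convex Lpol) px Ly.
by rewrite dotBr subr_ge0.
Qed.

(** Upper stop: the new gap is at most [(1 - (1 - theta) beta)] times the old one.
Lower stop: it is at most [beta] times the old one, as the best value found never
exceeds [f xhat]. *)
Lemma return_sound z st pts x' lb' : sound_state z st ->
  0 < beta < 1 -> 0 < theta < 1 -> minimizers f z -> lb <= f z ->
  enorm (z - xhat) <= r ->
  iter st pts (Return x' lb') ->
  lb' <= f z /\ f x' - lb' <= Defs.contraction beta theta * (f xhat - lb).
Proof.
move=> snd /andP[b0 b1] /andP[t0 t1] zmin lbz zr it.
have gap0 : 0 <= f xhat - lb by rewrite subr_ge0; exact: le_trans lbz (zmin _).
have le_beta : beta <= Defs.contraction beta theta by rewrite le_max lexx.
have le_theta : 1 - (1 - theta) * beta <= Defs.contraction beta theta.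
  by rewrite le_max lexx orbT.
have low : f (st_xu st) - lv <= Defs.contraction beta theta * (f xhat - lb).
  have h := sound_upper snd; apply: (le_trans _ (ler_wpM2r gap0 le_beta)).
  by rewrite /level; lra.
inversion it as [L0|x px rx|x px xr up|]; subst.
- split=> //; rewrite leNgt; apply/negP => /ltW zl.
  by have := sound_lower_set snd zl; rewrite L0.
- split=> //; rewrite leNgt; apply/negP => /ltW zl.
  have := is_prox_enorm_le px (sound_lower_set snd zl).
  by rewrite leNgt (le_lt_trans zr rx).
- split=> //; apply: (le_trans _ (ler_wpM2r gap0 le_theta)).
  by move: up; rewrite /level; lra.
Qed.

End GapReductionFacts.

(** * Length of one call *)

#[local] Arguments gamma_ : simpl never.

Section StepsizeFacts.
Context {R : realType}.
Variables (alpha : nat -> R) (rho c : R).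
Hypothesis alpha_step : stepsize_condition alpha rho c.

Lemma step_gt0 k : 0 < alpha k.+1.
Proof. by have [_ /(_ k.+1 isT)[/andP[]]] := alpha_step. Qed.

Lemma step_le1 k : alpha k.+1 <= 1.
Proof. by have [_ /(_ k.+1 isT)[/andP[]]] := alpha_step. Qed.

Lemma gamma_gt0 k : 0 < gamma_ alpha k.+1.
Proof.
elim: k => // k IH.
have [_ /(_ k.+2 isT)[_ gN0 _]] := alpha_step.
by rewrite lt_neqAle eq_sym gN0 gammaS mulr_ge0 ?(ltW IH)// subr_ge0 step_le1.
Qed.

Lemma tau_ge0 k (i : 'I_k) : 0 <= tau_ alpha rho i.
Proof. by rewrite divr_ge0 ?powR_ge0// ltW// gamma_gt0. Qed.

End StepsizeFacts.

(** A call started with gap [D] has at most [iter_coef * D^(-e)] iterations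
besides the one that ends it, where [e = (1 - rho) / (1 + 3 rho)]. *)
Definition iter_coef {R : realType} (beta theta mu c M rho : R) : R :=
  (4 `^ ((1 + rho) / 2) * c * M
   / (theta * beta * (1 + rho) * mu `^ ((1 + rho) / 2))) `^ (2 / (1 + 3 * rho)).

Section CallLength.
Context {R : realType} {n : nat}.
Variables (f : 'rV[R]_n -> R) (f' : 'rV[R]_n -> 'rV[R]_n).
Variables (alpha : nat -> R) (beta theta mu c M rho : R).
Variables (Om : set 'rV[R]_n) (xhat : 'rV[R]_n) (lb r : R).
Implicit Types (st : gap_state R n) (x z : 'rV[R]_n).
Local Notation lv := (level f beta xhat lb).
Local Notation iter := (gap_iter f f' alpha beta theta xhat lb r).
Hypothesis f'_sub : subgradient_selection f f'.
Hypothesis f_strong : strongly_convex f f' mu.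
Hypothesis mu_gt0 : 0 < mu.
Hypothesis f_smooth : smooth_on f f' Om M rho.
Hypothesis M_gt0 : 0 < M.
Hypothesis rho_01 : 0 <= rho <= 1.
Hypothesis c_gt0 : 0 < c.
Hypothesis alpha_step : stepsize_condition alpha rho c.
Hypothesis beta_01 : 0 < beta < 1.
Hypothesis theta_01 : 0 < theta < 1.
Hypothesis gap_gt0 : 0 < f xhat - lb.
Hypothesis r_ge0 : 0 <= r.
Hypothesis sqr_r : r ^+ 2 = 2 * (f xhat - lb) / mu.

Let rho1_gt0 : 0 < 1 + rho.
Proof. by case/andP: rho_01 => ? _; lra. Qed.

Let Mrho_ge0 : 0 <= M / (1 + rho).
Proof. by rewrite divr_ge0 ?ltW. Qed.

(** [trial_pt - lower_pt = alpha_k (x_k - x_(k-1))], and the linearization at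
[lower_pt] is bounded by [f] at [st_xu] and by the level at [x_k]. *)
Lemma trial_estimate st x :
  Om (lower_pt alpha st) -> Om (trial_pt alpha st x) ->
  lower_set f f' alpha beta xhat lb st x ->
  f (trial_pt alpha st x) - lv
    <= (1 - alpha (st_k st).+1) * (f (st_xu st) - lv)
       + M / (1 + rho)
         * (alpha (st_k st).+1 `^ (1 + rho) * enorm (x - st_x st) `^ (1 + rho)).
Proof.
move=> Ol Ot [_ Lx]; set a := alpha _.
have a0 : 0 < a := step_gt0 alpha_step _.
have a1 : a <= 1 := step_le1 alpha_step _.
have d_trial : trial_pt alpha st x - lower_pt alpha st = a *: (x - st_x st).
  by apply/rowP => i; rewrite !mxE -/a; ring.
have := f_smooth Ol Ot; rewrite d_trial enormZ ?(ltW a0)//.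
rewrite powRM ?enorm_ge0 ?(ltW a0)//.
have -> : a *: (x - st_x st) = (1 - a) *: (st_xu st - lower_pt alpha st)
    + a *: (x - lower_pt alpha st).
  by apply/rowP => i; rewrite !mxE -/a; ring.
rewrite dotDr !dotZr => h.
have hu := f'_sub (lower_pt alpha st) (st_xu st).
have a1' : 0 <= 1 - a by rewrite subr_ge0.
have {hu} := ler_wpM2l a1' hu.
have {Lx} := ler_wpM2l (ltW a0) Lx; rewrite /linearization.
by clearbody a; lra.
Qed.

(** [alpha_1 = 1], so the first search points are [x_0] and [x_1] themselves.  If
they are more than [r] apart, [strong_smooth_compare] bounds the initial gap
[mu / 2 * r ^+ 2], and the best value never exceeds [f xhat]. *)
Lemma first_upper_estimate st x : st_k st = 0%N -> st_xu st = xhat ->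
  Om (lower_pt alpha st) -> Om (trial_pt alpha st x) ->
  lower_set f f' alpha beta xhat lb st x ->
  f (upper_pt f alpha st x) - lv
    <= M / (1 + rho) * Num.min (enorm (x - st_x st)) r `^ (1 + rho).
Proof.
move=> k0 xu0 Ol Ot Lx.
have alpha1 : alpha 1%N = 1 by case: alpha_step.
have [Dr|rD] := leP (enorm (x - st_x st)) r.
  have := trial_estimate Ol Ot Lx; rewrite k0 alpha1 subrr mul0r add0r.
  rewrite powR1 mul1r; apply: le_trans.
  by rewrite lerD2r upper_pt_le_trial.
have lowE : lower_pt alpha st = st_x st.
  by rewrite /lower_pt k0 alpha1 subrr scale0r add0r scale1r.
have trialE : trial_pt alpha st x = x.
  by rewrite /trial_pt k0 alpha1 subrr scale0r add0r scale1r.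
rewrite lowE in Ol; rewrite trialE in Ot.
apply: (le_trans _ (strong_smooth_compare f_strong f_smooth (ltW M_gt0)
  rho_01 Ol Ot _)).
  have -> : mu / 2 * r ^+ 2 = f xhat - lb.
    by rewrite sqr_r; field; rewrite gt_eqF.
  have := upper_pt_le f alpha st x; rewrite xu0 /level => h.
  have : beta * (f xhat - lb) <= f xhat - lb.
    by rewrite ger_pMl//; case/andP: beta_01 => _ /ltW.
  lra.
by rewrite r_ge0 ltW.
Qed.

(** What is known in the middle of a call, after at least one iteration.  The
sequence [d] is the one of the displacements [enorm (x_i - x_(i-1))], except that
its first term is truncated at [r]. *)
Record estimate st : Prop := Estimate {
  est_near : enorm (st_x st - xhat) <= r;
  est_cut : st_Q st `<=`
    [set y | 0 <= dot (st_x st - xhat) (y - st_x st)];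
  est_gap : theta * beta * (f xhat - lb) < f (st_xu st) - lv;
  est_potential : exists d : nat -> R, [/\ forall i, 0 <= d i,
    \sum_(i < st_k st) d i ^+ 2 <= r ^+ 2 + enorm (st_x st - xhat) ^+ 2
  & (f (st_xu st) - lv) / gamma_ alpha (st_k st)
    <= M / (1 + rho) *
       \sum_(i < st_k st) tau_ alpha rho i * d i `^ (1 + rho)] }.

(** Dividing [trial_estimate] by [gamma_(k+1) = gamma_k (1 - alpha_(k+1))] makes
the potential additive; the squared displacements telescope by [enorm_step]. *)
Lemma estimate_continue st pts st' :
  (st_k st = 0%N -> st_xu st = xhat) -> ((0 < st_k st)%N -> estimate st) ->
  (forall z, z \in pts -> Om z) ->
  iter st pts (Continue st') -> (0 < st_k st')%N /\ estimate st'.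
Proof.
move=> st0 stS Opts it; inversion it as [| | |x Q px xr up polQ sub half]; subst.
have Ol : Om (lower_pt alpha st) by apply: Opts; rewrite inE eqxx.
have Ot : Om (trial_pt alpha st x) by apply: Opts; rewrite !inE eqxx orbT.
have Lx := px.1.
split=> //; split=> //=; first by move: up; rewrite /level; lra.
case k0 : (st_k st) => [|k].
  (* Only the first term of this constant sequence enters the sums. *)
  exists (fun=> Num.min (enorm (x - st_x st)) r); split=> [_||].
  - by rewrite le_min enorm_ge0 r_ge0.
  - rewrite big_ord1; apply: ler_wpDr; first exact: sqr_ge0.
    by rewrite ler_sqr ?nnegrE ?ge_min ?lexx ?orbT// le_min enorm_ge0 r_ge0.
  - rewrite big_ord1 /tau_/= (_ : alpha 1%N = 1); last by case: alpha_step.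
    rewrite /gamma_ !divr1 powR1 mul1r.
    exact: first_upper_estimate (st0 k0) Ol Ot Lx.
have [_ cut _ [d [d0 dsum dpot]]] : estimate st by apply: stS; rewrite k0.
have g0 := gamma_gt0 alpha_step k; have g1 := gamma_gt0 alpha_step k.+1.
exists (fun i => if i == k.+1 then enorm (x - st_x st) else d i).
have dE (i : 'I_k.+1) : (i == k.+1 :> nat) = false by rewrite ltn_eqF.
split=> [i||].
- by case: ifP => // _; exact: enorm_ge0.
- rewrite big_ord_recr /= eqxx; under eq_bigr do rewrite dE.
  rewrite k0 in dsum; have := enorm_step (cut _ Lx.1); move: dsum.
  by lra.
- rewrite big_ord_recr /= eqxx; under eq_bigr do rewrite dE.
  have te := trial_estimate Ol Ot Lx; rewrite k0/= in te.
  have {te} te :=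
    le_trans (lerD (upper_pt_le_trial f alpha st x) (lexx (- lv))) te.
  rewrite mulrDr; rewrite k0 in dpot.
  apply: (le_trans _ (lerD dpot (lexx _))).
  rewrite ler_pdivrMr// mulrDl; apply: (le_trans te); rewrite lerD//.
    by rewrite gammaS mulrC mulrA mulfVK ?gt_eqF.
  by rewrite -[leRHS]mulrA ler_wpM2l// mulrAC /tau_/= mulfVK ?gt_eqF.
Qed.

(** The potential, Hoelder's inequality and the stepsize condition give
[theta beta D <= M / (1 + rho) * c * k^(-(1 + 3 rho) / 2) * (2 r^2)^((1 + rho) / 2)]
with [2 r^2 = 4 D / mu]; the bound is this inequality solved for [k]. *)
Lemma call_length_le st : ((0 < st_k st)%N -> estimate st) ->
  (st_k st)%:R <= iter_coef beta theta mu c M rho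
                  * (f xhat - lb) `^ (- ((1 - rho) / (1 + 3 * rho))).
Proof.
have [k0 _|k0 /(_ isT)[near _ gap [d [d0 dsum dpot]]]] := posnP (st_k st).
  by rewrite k0 mulr_ge0 ?powR_ge0.
set D := f xhat - lb in gap *; set k := st_k st in k0 dsum dpot *.
have [b0 b1] := andP beta_01; have [t0 t1] := andP theta_01.
have [rho0 rho1] := andP rho_01.
have kR : 0 < k%:R :> R by rewrite ltr0n.
have gk : 0 < gamma_ alpha k.
  by rewrite -(prednK k0); exact: gamma_gt0 alpha_step _.
have [_ /(_ _ k0)[_ _ hc]] := alpha_step.
pose s := (1 + rho) / 2.
have s0 : 0 < s by rewrite divr_gt0.
have d2 : \sum_(i < k) d i ^+ 2 <= 4 * D / mu.
  apply: (le_trans dsum); apply: (@le_trans _ _ (r ^+ 2 + r ^+ 2)).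
    by rewrite lerD2l ler_sqr ?nnegrE ?enorm_ge0.
  by rewrite sqr_r -/D le_eqVlt; apply/orP; left; apply/eqP; ring.
have D0 : 0 < D := gap_gt0.
have hold : \sum_(i < k) tau_ alpha rho i * d i `^ (1 + rho)
    <= lp_norm (tau_exponent rho) (@tau_ _ alpha rho k) * (4 * D / mu) `^ s.
  have := @holder_tau _ rho k (@tau_ _ alpha rho k) (fun i => d i) rho_01
    (fun=> d0 _).
  under eq_bigr => i _ do rewrite (ger0_norm (tau_ge0 alpha_step i)).
  move/le_trans; apply; rewrite ler_wpM2l ?lp_norm_ge0//.
  apply: ge0_ler_powR => //; rewrite ?nnegrE ?(ltW s0)//.
    by apply: sumr_ge0 => i _; exact: sqr_ge0.
  by rewrite divr_ge0 ?mulr_ge0 ?(ltW D0) ?(ltW mu_gt0).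
have main : theta * beta * D <=
    M / (1 + rho) * (c * k%:R `^ (- ((1 + 3 * rho) / 2)) * (4 * D / mu) `^ s).
  apply: (le_trans (ltW gap)).
  move: dpot; rewrite ler_pdivrMr// => /le_trans; apply.
  rewrite -[leLHS]mulrA ler_wpM2l//.
  apply: (@le_trans _ _ (gamma_ alpha k * lp_norm (tau_exponent rho)
      (@tau_ _ alpha rho k) * (4 * D / mu) `^ s)).
    by rewrite [leLHS]mulrC -[leRHS]mulrA ler_pM2l.
  by rewrite ler_wpM2r ?powR_ge0.
pose p := (1 + 3 * rho) / 2.
have p0 : 0 < p by rewrite divr_gt0//; lra.
rewrite -/p powRN in main.
pose B := 4 `^ s * c * M / (theta * beta * (1 + rho) * mu `^ s).
have B0 : 0 <= B.
  rewrite divr_ge0 ?mulr_ge0 ?powR_ge0 ?(ltW c_gt0) ?(ltW M_gt0)//.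
  - exact: ltW.
  - exact: ltW.
  - exact: ltW.
have kB : k%:R `^ p <= B * D `^ (- ((1 - rho) / 2)).
  have kp := powR_gt0 p kR.
  have mus := powR_gt0 s mu_gt0.
  have Ds : D `^ s = D * D `^ (- ((1 - rho) / 2)).
    rewrite -{2}(powRr1 (ltW D0)) -powRD; last by rewrite (gt_eqF D0) implybT.
    by congr (_ `^ _); rewrite /s; field.
  have -> : B * D `^ (- ((1 - rho) / 2)) =
      M / (1 + rho) * (c * (4 * D / mu) `^ s) / (theta * beta * D).
    rewrite powRM ?invr_ge0 ?(ltW mu_gt0)//; last by rewrite mulr_ge0 ?ltW.
    rewrite powRM ?(ltW D0)// Ds -[mu^-1]powR_inv1 ?(ltW mu_gt0)// -powRrM.
    rewrite mulN1r (powRN mu) /B; field.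
    by rewrite !gt_eqF.
  rewrite ler_pdivlMr; last by rewrite !mulr_gt0.
  move: main; rewrite -(ler_pM2l kp); move/le_trans; apply.
  by rewrite le_eqVlt; apply/orP; left; apply/eqP; field; rewrite !gt_eqF.
have -> : iter_coef beta theta mu c M rho * D `^ (- ((1 - rho) / (1 + 3 * rho)))
    = (B * D `^ (- ((1 - rho) / 2))) `^ p^-1.
  rewrite powRM ?powR_ge0// -powRrM /iter_coef -/s -/B /p invf_div.
  by congr (_ * _ `^ _); field; lra.
have -> : k%:R = (k%:R `^ p) `^ p^-1 :> R.
  by rewrite -powRrM divff ?gt_eqF// powRr1 ?ltW.
apply: ge0_ler_powR; rewrite ?nnegrE ?invr_ge0 ?(ltW p0)//.
exact: mulr_ge0 B0 (powR_ge0 _ _).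
Qed.

End CallLength.

(** * Counting the iterations of a run *)

Section FAPLRun.
Context {R : realType} {n : nat}.
Variables (f : 'rV[R]_n -> R) (f' : 'rV[R]_n -> 'rV[R]_n).
Variables (alpha : nat -> R) (beta theta mu c M rho eps : R).
Variables (Om : set 'rV[R]_n) (z p0 : 'rV[R]_n) (lb1 : R).
Hypothesis f'_sub : subgradient_selection f f'.
Hypothesis f_strong : strongly_convex f f' mu.
Hypothesis mu_gt0 : 0 < mu.
Hypothesis z_min : minimizers f z.
Hypothesis f_smooth : smooth_on f f' Om M rho.
Hypothesis M_gt0 : 0 < M.
Hypothesis rho_01 : 0 <= rho <= 1.
Hypothesis c_gt0 : 0 < c.
Hypothesis alpha_step : stepsize_condition alpha rho c.
Hypothesis beta_01 : 0 < beta < 1.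
Hypothesis theta_01 : 0 < theta < 1.
Hypothesis eps_gt0 : 0 < eps.
Hypothesis lb1_le : lb1 <= f z.

Let q := Defs.contraction beta theta.
Let e := (1 - rho) / (1 + 3 * rho).
Let A := iter_coef beta theta mu c M rho.
Let gap1 := f p0 - lb1.
Let S := call_bound beta theta eps gap1.

Let q_gt0 : 0 < q.
Proof. by case/andP: beta_01 => b0 _; rewrite lt_max b0. Qed.

Let q_lt1 : q < 1.
Proof.
case/andP: beta_01 => b0 b1; case/andP: theta_01 => t0 t1.
by rewrite gt_max b1/= ltrBlDr ltrDl mulr_gt0// subr_gt0.
Qed.

Let e_ge0 : 0 <= e.
Proof. by case/andP: rho_01 => ? ?; rewrite divr_ge0//; lra. Qed.

Let A_ge0 : 0 <= A.
Proof. exact: powR_ge0. Qed.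

Definition geom_sum s : R := \sum_(j < s) (q `^ e) ^+ j.

Lemma geom_sum0 : geom_sum 0 = 0.
Proof. by rewrite /geom_sum big_ord0. Qed.

Lemma geom_sumS s : geom_sum s.+1 = 1 + q `^ e * geom_sum s.
Proof.
rewrite /geom_sum big_ord_recl expr0 mulr_sumr; congr (_ + _).
by apply: eq_bigr => i _; rewrite exprS.
Qed.

Lemma geom_sum_ge0 s : 0 <= geom_sum s.
Proof. by apply: sumr_ge0 => i _; rewrite exprn_ge0 ?powR_ge0. Qed.

(** A call can only follow [s] completed ones if [q ^+ s * gap1] still exceeds
[eps], that is, if [s] is below the logarithm; then [s.+1] is at most its ceiling. *)
Lemma call_bound_gt s : eps < q ^+ s * gap1 -> s.+1%:Z <= S.
Proof.
move=> h; have qs := exprn_gt0 s q_gt0.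
have g0 : 0 < gap1 by rewrite -(pmulr_rgt0 _ qs); exact: lt_trans h.
have lq : 0 < ln (1 / q) by rewrite ln_gt0// div1r invf_gt1.
suff : s%:R < log_base (1 / q) (gap1 / eps).
  move=> sL; rewrite /S /call_bound le_max; apply/orP; right.
  rewrite -addn1 PoszD lezD1 ceil_gt_int; exact: sL.
rewrite /log_base ltr_pdivlMr// mulr_natl -lnXn ?div1r ?invr_gt0//.
rewrite ltr_ln ?posrE ?exprn_gt0 ?invr_gt0 ?divr_gt0//.
by rewrite ltr_pdivlMr// exprVn mulrC ltr_pdivrMr// mulrC.
Qed.

(** [s] counts the completed calls.  At the test of the loop [D] plays the role of
the gap with which the last of them was started.  It is kept apart from the
current gap, which may be [0], and [0 `^ (- e)] is not infinite; the condition
[eps < D] is what remains of the test passed by that call.  Before the first call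
any large [D] will do. *)
Definition run_inv (cfg : fapl_config R n) (N : nat) : Prop :=
  match cfg with
  | AtTest xhat lb => lb <= f z /\ exists s D,
      [/\ s%:Z <= S, f xhat - lb <= q ^+ s * gap1,
          eps < D, f xhat - lb <= q * D
        & N%:R <= s%:R + A * D `^ (- e) * geom_sum s]
  | InCall xhat lb st =>
      let D := f xhat - lb in
      [/\ lb <= f z /\ eps < D,
          sound_state f beta xhat lb z st,
          st_k st = 0%N -> st_xu st = xhat,
          (0 < st_k st)%N ->
            estimate f alpha beta theta M rho xhat lb
              (call_radius f mu xhat lb) st
        & exists s, [/\ s.+1%:Z <= S, D <= q ^+ s * gap1
            & N%:R <= s%:R + (st_k st)%:R
                + A * D `^ (- e) * (q `^ e * geom_sum s)]]
  end.

Lemma run_inv_start : run_inv (AtTest p0 lb1) 0.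
Proof.
split=> //; exists 0%N, (eps + 1 + gap1 / q).
have g0 : 0 <= gap1 by rewrite subr_ge0; exact: le_trans (z_min _).
have gq : 0 <= gap1 / q by rewrite divr_ge0// ltW.
split.
- by rewrite le_max lexx.
- by rewrite expr0 mul1r.
- by lra.
- rewrite mulrDr mulrCA divff ?gt_eqF// mulr1 -/gap1 lerDr.
  by rewrite mulr_ge0 ?addr_ge0// ltW.
- by rewrite geom_sum0 mulr0 addr0.
Qed.

Lemma sqr_radius xhat lb : 0 < f xhat - lb ->
  call_radius f mu xhat lb ^+ 2 = 2 * (f xhat - lb) / mu.
Proof. by move=> g0; rewrite sqr_sqrtr// divr_ge0 ?mulr_ge0// ltW. Qed.

Lemma minimizer_in_radius xhat lb : lb <= f z ->
  enorm (z - xhat) <= call_radius f mu xhat lb.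
Proof.
move=> lbz; rewrite -opprB enormN -(ger0_norm (enorm_ge0 _)) -sqrtr_sqr.
rewrite ler_wsqrtr// ler_pdivlMr//.
have := quadratic_growth f_strong xhat z_min.
by lra.
Qed.

(** Starting a call with gap [Delta <= q D] turns [D `^ (- e)] into at most
[q `^ e * Delta `^ (- e)], which shifts the geometric sum by one; the call that
ends afterwards supplies the missing first term. *)
Lemma run_inv_step cfg N pts cfg' N' :
  run_inv cfg N -> (forall x, x \in pts -> Om x) ->
  fapl_step f f' alpha beta theta mu eps cfg N' pts cfg' ->
  run_inv cfg' (N + N').
Proof.
move=> inv Opts st.
case: st inv Opts => {cfg N' pts cfg'}
  [xhat lb x0 gap _|xhat lb st pts st' it|xhat lb st pts x' lb' it] /=.
- move=> [lbz [s [D [sS gs epsD gD NA]]]] _.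
  have D0 : 0 < D := lt_trans eps_gt0 epsD.
  have g0 : 0 < f xhat - lb := lt_trans eps_gt0 gap.
  split=> //; first exact: sound_init.
  exists s; split=> //; first exact/call_bound_gt/(lt_le_trans gap).
  rewrite addn0 addr0; apply: (le_trans NA); rewrite lerD2l mulrA.
  rewrite ler_wpM2r ?geom_sum_ge0// -mulrA ler_wpM2l//.
  rewrite !powRN -[q `^ e]invrK -invfM lef_pV2 ?posrE; last 2 first.
  + by rewrite powR_gt0.
  + by rewrite divr_gt0 ?powR_gt0.
  rewrite ler_pdivrMr ?powR_gt0// -powRM ?(ltW D0) ?(ltW q_gt0)// mulrC.
  by apply: ge0_ler_powR; rewrite ?nnegrE ?(ltW g0)// mulr_ge0 ?ltW.
- move=> [[lbz gap] snd st0 stS [s [sS gs NA]]] Opts.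
  have g0 : 0 < f xhat - lb := lt_trans eps_gt0 gap.
  have kS : st_k st' = (st_k st).+1 by inversion it.
  have [k0 est] := estimate_continue f'_sub f_strong mu_gt0 f_smooth M_gt0
    rho_01 alpha_step beta_01 g0 (sqrtr_ge0 _) (sqr_radius g0) st0 stS
    Opts it.
  split=> //.
  + exact: sound_continue snd it.
  + by rewrite kS.
  + by exists s; split=> //; rewrite kS -natr1 natrD; lra.
- move=> [[lbz gap] snd st0 stS [s [sS gs NA]]] Opts.
  have g0 : 0 < f xhat - lb := lt_trans eps_gt0 gap.
  have [lbz' gap'] := return_sound f'_sub snd beta_01 theta_01 z_min lbz
    (minimizer_in_radius xhat lbz) it.
  split=> //; exists s.+1, (f xhat - lb); split=> //.
    rewrite exprS -mulrA; apply: (le_trans gap'); rewrite ler_wpM2l//.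
    exact: ltW.
  have kA := call_length_le mu_gt0 M_gt0 rho_01 c_gt0 alpha_step beta_01
    theta_01 g0 (sqrtr_ge0 _) (sqr_radius g0) stS.
  rewrite -/A -/e in kA.
  rewrite geom_sumS mulrDr mulr1 natrD -natr1; lra.
Qed.

Lemma run_inv_run cfg N pts :
  fapl_run f f' alpha beta theta mu eps p0 lb1 cfg N pts ->
  (forall x, x \in pts -> Om x) -> run_inv cfg N.
Proof.
elim=> {cfg N pts} [|cfg N pts N' pts' cfg' _ IH st] Opts.
  exact: run_inv_start.
apply: (run_inv_step (IH _) _ st) => x xin; apply: Opts.
  by rewrite mem_cat xin.
by rewrite mem_cat xin orbT.
Qed.

Lemma run_inv_count cfg N : run_inv cfg N ->
  exists s, s%:Z <= S /\ N%:R <= s%:R + A * eps `^ (- e) * geom_sum s.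
Proof.
have mono D s : eps < D ->
    A * D `^ (- e) * geom_sum s <= A * eps `^ (- e) * geom_sum s.
  move=> eD; have D0 := lt_trans eps_gt0 eD.
  rewrite ler_wpM2r ?geom_sum_ge0// ler_wpM2l// !powRN lef_pV2 ?posrE ?powR_gt0//.
  apply: ge0_ler_powR; rewrite ?nnegrE ?(ltW eD) ?(ltW D0) ?(ltW eps_gt0)//.
case: cfg => [xhat lb [_ [s [D [sS _ eD _ NA]]]]|xhat lb st].
  by exists s; split=> //; apply: (le_trans NA); rewrite lerD2l; exact: mono.
move=> [[lbz gap] snd st0 stS [s [sS _ NA]]].
have g0 : 0 < f xhat - lb := lt_trans eps_gt0 gap.
exists s.+1; split=> //; apply: (le_trans NA).
have kA := call_length_le mu_gt0 M_gt0 rho_01 c_gt0 alpha_step beta_01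
  theta_01 g0 (sqrtr_ge0 _) (sqr_radius g0) stS.
rewrite -/A -/e in kA.
have := mono _ s.+1 gap; rewrite geom_sumS !mulrDr mulr1 -natr1.
lra.
Qed.

Lemma run_inv_progress cfg N : run_inv cfg N ->
  (exists xhat lb, [/\ cfg = AtTest xhat lb, f xhat - lb <= eps
                     & eps_solution f (f z) eps xhat])
  \/ (exists N' pts' cfg',
        fapl_step f f' alpha beta theta mu eps cfg N' pts' cfg').
Proof.
case: cfg => [xhat lb [lbz _]|xhat lb st [_ snd _ _ _]].
  have [le|gt] := leP (f xhat - lb) eps.
    left; exists xhat, lb; split=> //; rewrite /eps_solution.
    by apply: le_trans le; rewrite lerD2l lerN2.
  right; do 3 eexists; apply: (@StepCall _ _ _ _ _ _ _ _ _ _ _ xhat gt).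
  by rewrite /eball/= subrr enorm0 sqrtr_ge0.
right; have [pts [[st'|x' lb'] it]] := @iter_progress _ _ f f' alpha beta theta
  xhat lb (call_radius f mu xhat lb) z st snd.
  by do 3 eexists; exact: StepContinue it.
by do 3 eexists; exact: StepReturn it.
Qed.

(** For [rho = 1] the exponent [e] vanishes and the geometric sum counts calls. *)
Lemma smooth_count N s : rho = 1 -> s%:Z <= S ->
  N%:R <= s%:R + A * eps `^ (- e) * geom_sum s ->
  N%:R <= smooth_bound beta theta mu c M S.
Proof.
move=> rho1 sS; have e0 : e = 0 by rewrite /e rho1 subrr mul0r.
rewrite /geom_sum e0 oppr0 !powRr0 mulr1.
under eq_bigr do rewrite expr1n.
rewrite sumr_const card_ord => /le_trans; apply.
have -> : A = Num.sqrt (2 * c * M / (theta * beta * mu)).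
  rewrite /A /iter_coef rho1.
  have -> : (1 + 1) / 2 = 1 :> R by field.
  have -> : 2 / (1 + 3 * 1) = 2^-1 :> R by field.
  rewrite !powRr1 ?(ltW mu_gt0)// powR12_sqrt; last first.
    have [b0 _] := andP beta_01; have [t0 _] := andP theta_01.
    by rewrite divr_ge0 ?mulr_ge0 ?ltW.
  congr (Num.sqrt _); field.
  have [b0 _] := andP beta_01; have [t0 _] := andP theta_01.
  by rewrite !gt_eqF.
rewrite /smooth_bound mulrDr mulr1 addrC mulrC.
have sR : s%:R <= S%:~R :> R by rewrite -[s%:R]/(s%:Z%:~R) ler_int.
by rewrite lerD// ler_wpM2r ?sqrtr_ge0.
Qed.

(** Besides summing the geometric series, this trades the factor
[4 `^ ((1 + rho) / 2)] of [iter_coef] for the larger [4 `^ (1 + rho)]. *)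
Lemma weakly_smooth_count N s : rho < 1 -> s%:Z <= S ->
  N%:R <= s%:R + A * eps `^ (- e) * geom_sum s ->
  N%:R <= weakly_smooth_bound beta theta mu eps c M rho S.
Proof.
move=> rho1 sS /le_trans; apply.
have [rho0 _] := andP rho_01.
have [b0 _] := andP beta_01; have [t0 _] := andP theta_01.
have e_gt0 : 0 < e by rewrite divr_gt0//; lra.
have w_lt1 : q `^ e < 1.
  rewrite [ltRHS](_ : 1 = 1 `^ e); last by rewrite powR1.
  by apply: gt0_ltr_powR; rewrite ?nnegrE ?(ltW q_gt0).
rewrite /weakly_smooth_bound -/q -/e lerD//.
  by rewrite -[s%:R]/(s%:Z%:~R) ler_int.
rewrite mulrC; apply: ler_pM.
- exact: geom_sum_ge0.
- by rewrite mulr_ge0 ?powR_ge0.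
- rewrite ler_pdivlMr ?subr_gt0// mulrC.
  (* (1 - w) * sum_(j < s) w ^ j = 1 - w ^ s *)
  rewrite -[_ * _]opprK -mulNr opprB -subrX1 opprB gerBl.
  by rewrite exprn_ge0 ?powR_ge0.
rewrite /A /iter_coef.
have -> : eps `^ (- e) = (eps `^ (- ((1 - rho) / 2))) `^ (2 / (1 + 3 * rho)).
  by rewrite -powRrM; congr (_ `^ _); rewrite /e; field; lra.
have r1 : 0 < 1 + rho by lra.
have den0 : 0 <= theta * beta * (1 + rho) * mu `^ ((1 + rho) / 2).
  by rewrite !mulr_ge0 ?powR_ge0 ?ltW.
have num0 a : 0 <= 4 `^ a * c * M by rewrite !mulr_ge0 ?powR_ge0 ?ltW.
rewrite -(powRM _ (divr_ge0 (num0 _) den0) (powR_ge0 _ _)).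
apply: ge0_ler_powR; rewrite ?nnegrE.
- by rewrite divr_ge0//; lra.
- by rewrite mulr_ge0 ?powR_ge0// divr_ge0.
- by rewrite divr_ge0// mulr_ge0 ?powR_ge0.
rewrite powRN -[leLHS]mulrA -invfM ler_wpM2r//.
  by rewrite invr_ge0 mulr_ge0 ?powR_ge0.
rewrite -!mulrA ler_wpM2r//; first by rewrite mulr_ge0 ?ltW.
by apply: ler_powR; lra.
Qed.

End FAPLRun.

Theorem theorem4p1 (R : realType) (n : nat)
    (f : 'rV[R]_n -> R) (f' : 'rV[R]_n -> 'rV[R]_n) (mu fstar : R)
    (xbar : 'rV[R]_n) (M rho : set 'rV[R]_n -> R) (Omega : set 'rV[R]_n)
    (alpha : nat -> R) (c beta theta eps : R)
    (p0 : 'rV[R]_n) (lb1 : R)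
    (f_convex : convex_fun f)
    (f'_subgradient : subgradient_selection f f')
    (mu_gt0 : 0 < mu)
    (f_strong : strongly_convex f f' mu)
    (fstar_min : is_min_value f fstar)
    (f_smooth : smoothness_condition f f' xbar M rho)
    (Omega_closed : closed Omega)
    (Omega_ball : Omega `<=` eball xbar (4 * dist_to_minimizers f xbar))
    (c_gt0 : 0 < c)
    (alpha_step : stepsize_condition alpha (rho Omega) c)
    (beta_01 : 0 < beta < 1)
    (theta_01 : 0 < theta < 1)
    (eps_gt0 : 0 < eps)
    (lb1_le : lb1 <= fstar) :
  let ub1 := f p0 in
  let S := call_bound beta theta eps (ub1 - lb1) in
  forall (cfg : fapl_config R n) (N : nat) (pts : seq 'rV[R]_n),
    fapl_run f f' alpha beta theta mu eps p0 lb1 cfg N pts ->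
    (forall z, z \in pts -> Omega z) ->
    [/\ rho Omega = 1 ->
          N%:R <= smooth_bound beta theta mu c (M Omega) S,
        rho Omega < 1 ->
          N%:R <= weakly_smooth_bound beta theta mu eps c (M Omega)
                    (rho Omega) S
      & (exists xhat lb, [/\ cfg = AtTest xhat lb, f xhat - lb <= eps
                           & eps_solution f fstar eps xhat])
        \/ (exists N' pts' cfg',
              fapl_step f f' alpha beta theta mu eps cfg N' pts' cfg')].
Proof.
move=> ub1 S cfg N pts run Opts.
have [M_gt0 rho_01 smooth] := f_smooth _ Omega_closed Omega_ball.
have [z z_min fzE] := fstar_min; rewrite -fzE in lb1_le *.
have inv := run_inv_run f'_subgradient f_strong mu_gt0 z_min smooth M_gt0 rho_01
  c_gt0 alpha_step beta_01 theta_01 eps_gt0 lb1_le run Opts.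
have [s [sS Ns]] := run_inv_count mu_gt0 M_gt0 rho_01 c_gt0 alpha_step
  beta_01 theta_01 eps_gt0 inv.
split=> [rho1|rho1|].
- exact: smooth_count sS Ns.
- exact: weakly_smooth_count sS Ns.
- exact: run_inv_progress inv.
Qed.
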